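(* Let $\tau:[0,\infty)\to[0,\infty)$ be continuous with $\lim_{t\to\infty}\{t-\tau(t)\}=\infty$, let $-\bar{\tau}=\inf_{t\ge 0}\{t-\tau(t)\}$, and suppose $\lim_{t\to\infty}\tau(t)/t=q$ for some $q\in(0,1)$. Let $g:[0,\infty)\to[0,\infty)$ be continuous with $g(0)=0$, $g(x)>0$ for $x>0$, such that there is $\delta_1>0$ with $g\in C^1(0,\delta_1)$ and $g'(x)>0$ for $x\in(0,\delta_1)$, and there is $\beta>1$ with $g'\in\mathrm{RV}_0(\beta-1)$. Let $a>b>0$ obey $$a<b\left(\frac{1}{1-q}\right)^{\beta/(\beta-1)}.$$ Let $\psi\in C([-\bar\tau,0];(0,\infty))$. If the solution $x$ of $$x'(t)=-ag(x(t))+bg(x(t-\tau(t))),\quad t\ge 0;\qquad x(t)=\psi(t),\quad t\in[-\bar\tau,0],$$ obeys $x(t)\to0$ as $t\to\infty$, then $$\lim_{t\to\infty}\frac{\log x(t)}{\log t}=-\frac1\beta\,\frac{1}{\log(1/(1-q))}\log\left(\frac ab\right).$$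
   Context: A function $f$, positive near $0$ on the right, is regularly varying at zero with exponent $\alpha\in\mathbb{R}$, written $f\in\mathrm{RV}_0(\alpha)$, if $\lim_{t\to0^+}f(\lambda t)/f(t)=\lambda^\alpha$ for all $\lambda>0$. A solution of the delay equation is a continuous function $x:[-\bar\tau,\infty)\to(0,\infty)$, differentiable on $[0,\infty)$ (one-sided at $0$), satisfying the equation for all $t\ge0$ and equal to $\psi$ on $[-\bar\tau,0]$; solutions are positive. *)

(* Defs.v *)
(* Stdlib reals with Coquelicot. *)
From Stdlib Require Export Reals.
From Coquelicot Require Export Coquelicot.
Open Scope R_scope.

Definition RV0 (f : R -> R) (alpha : R) : Prop :=
  (exists d : R, 0 < d /\ forall t : R, 0 < t < d -> 0 < f t) /\
  (forall lambda : R, 0 < lambda ->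
     filterlim (fun t => f (lambda * t) / f t) (at_right 0)
       (locally (Rpower lambda alpha))).

Definition is_right_derive (f : R -> R) (t l : R) : Prop :=
  filterlim (fun h => (f (t + h) - f t) / h) (at_right 0) (locally l).

(* Functions on a part of R are total functions whose values outside that part
   are arbitrary; the derivative at 0 is therefore taken from the right. *)
Definition is_solution (a b taubar : R) (g tau psi x : R -> R) : Prop :=
  let rhs t := - a * g (x t) + b * g (x (t - tau t)) in
  (forall t : R, - taubar <= t -> 0 < x t) /\
  continuous_on (fun t => - taubar <= t) x /\
  is_right_derive x 0 (rhs 0) /\
  (forall t : R, 0 < t -> is_derive x t (rhs t)) /\
  (forall t : R, - taubar <= t <= 0 -> x t = psi t).

(* Main.v *)
Require Import Defs.
From Stdlib Require Import Reals Lra.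
From Coquelicot Require Import Coquelicot.
Open Scope R_scope.

(** Write s t = t - tau t, so that s t / t tends to 1 - q, and let kappa be the
    exponent for which a (t ^ - kappa) ^ beta = b (((1 - q) t) ^ - kappa) ^ beta,
    that is kappa = ln (a / b) / (beta ln (1 / (1 - q))).  Since g behaves like a
    power beta, the function t ^ - kappa balances the two terms on the right of the
    equation; the bound on a / b says exactly that kappa (beta - 1) < 1, and then
    the derivative of t ^ - m, for m near kappa, is negligible against
    g (t ^ - m).  So x should decay with exponent kappa.

    To prove it, w t = ln (x t) + m ln t is shown to be bounded above for each
    m < kappa and bounded below for each m > kappa; dividing by ln t gives the limit
    ([is_lim_log_ratio]).  Both bounds come from one maximum argument
    ([bounded_above_of_delay_maximum]): if w grew past every level, then at the first
    time t at which it attains a new high level it would satisfy w (s t) <= w t and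
    have nonnegative derivative.  But w (s t) <= w t says that
    x (s t) <= (t / s t) ^ m x t, where t / s t is close to 1 / (1 - q).  Regular
    variation at a single dilation factor then compares g (x (s t)) with g (x t).
    For m < kappa it gives x' <= - c g (x t) with c > 0, and
    g (x t) / x t >= x t ^ p >= t ^ (- m p) with m p < 1 beats the term m / t in w'
    ([delay_power_upper_bound]).  For m > kappa the same argument applied to - w gives
    x' > 0, a contradiction without any rate ([delay_power_lower_bound]).

    Working with ln x instead of an asymptotic inverse of g keeps the argument free
    of uniform convergence: only g itself, which is monotone near 0, has to be
    regularly varying, and this passes from g' to g by Cauchy's mean value theorem
    ([RV0_primitive]). *)

(** * One-sided limits and logarithms *)

Lemma ln_le_inv (u v : R) : 0 < u -> 0 < v -> ln u <= ln v -> u <= v.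
Proof.
intros Hu Hv H. apply Rnot_lt_le. intros Hlt. apply ln_increasing in Hlt; lra.
Qed.

Lemma at_right_0_iff (P : R -> Prop) :
  at_right 0 P <-> exists d, 0 < d /\ forall y, 0 < y < d -> P y.
Proof.
split.
- intros [e He]. exists e. split. apply cond_pos.
  intros y Hy. apply He; try lra.
  change (Rabs (y - 0) < e). rewrite Rabs_right; lra.
- intros [d [Hd H]]. exists (mkposreal d Hd). intros y Hb Hy. apply H.
  change (Rabs (y - 0) < d) in Hb. rewrite Rabs_right in Hb; lra.
Qed.

(** * Regular variation at zero *)

Lemma increasing_of_derivative (g : R -> R) (d : R) :
  (forall y, 0 < y < d -> ex_derive g y /\ 0 < Derive g y) ->
  forall y z, 0 < y <= z -> z < d -> g y <= g z.
Proof.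
intros H y z Hyz Hz.
destruct (MVT_gen g y z (Derive g)) as [c [Hc Heq]].
- intros u. rewrite Rmin_left, Rmax_right by lra. intros Hu.
  apply Derive_correct, H. lra.
- intros u. rewrite Rmin_left, Rmax_right by lra. intros Hu.
  apply continuity_pt_filterlim, (@ex_derive_continuous R_AbsRing R_NormedModule), H. lra.
- rewrite Rmin_left, Rmax_right in Hc by lra.
  assert (0 < Derive g c) by (apply H; lra). nra.
Qed.

(** By Cauchy's mean value theorem on [0, y], the quotient g (lambda y) / g y equals
    lambda g' (lambda xi) / g' xi for some xi in ]0, y[, and xi tends to 0 with y. *)
Lemma RV0_primitive (g : R -> R) (alpha d : R) :
  0 < d -> continuous_on (fun y => 0 <= y) g -> g 0 = 0 ->
  (forall y, 0 < y -> 0 < g y) ->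
  (forall y, 0 < y < d -> ex_derive g y /\ 0 < Derive g y) ->
  RV0 (Derive g) (alpha - 1) -> RV0 g alpha.
Proof.
intros Hd Hcont Hg0 Hpos Hder [_ Hrv].
split; [exists 1; split; [lra|intros t Ht; apply Hpos; lra]|].
intros lambda Hl.
(* g is only controlled on the right of 0; G extends it by a constant so that
   two-sided continuity at 0 is available for Rolle's theorem. *)
set (G := fun s => g (Rmax 0 s)).
assert (HGcont : forall s, continuous G s).
{ intros s. unfold continuous, G.
  apply filterlim_comp with (G := within (fun y => 0 <= y) (locally (Rmax 0 s))).
  - intros P [e He]. exists e. intros u Hu. apply He; [|apply Rmax_l].
    change (Rabs (Rmax 0 u - Rmax 0 s) < e). change (Rabs (u - s) < e) in Hu.
    revert Hu. unfold Rmax. repeat destruct Rle_dec; unfold Rabs; repeat destruct Rcase_abs; lra.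
  - apply Hcont, Rmax_l. }
assert (HGg : forall s, 0 <= s -> G s = g s) by (intros s Hs; unfold G; now rewrite Rmax_right).
assert (HGder : forall s, 0 < s < d -> is_derive G s (Derive g s)).
{ intros s Hs. apply is_derive_ext_loc with g; [|apply Derive_correct, Hder, Hs].
  exists (mkposreal s (proj1 Hs)). intros u Hu. change (Rabs (u - s) < s) in Hu.
  symmetry. apply HGg. revert Hu. unfold Rabs. destruct Rcase_abs; lra. }
apply filterlim_locally. intros eps.
assert (Hlim : filterlim (fun t => lambda * (Derive g (lambda * t) / Derive g t)) (at_right 0)
   (locally (lambda * Rpower lambda (alpha - 1)))).
{ eapply filterlim_comp; [apply Hrv, Hl|]. 
  apply (filterlim_scal_r lambda (Rpower lambda (alpha - 1))). }
replace (lambda * Rpower lambda (alpha - 1)) with (Rpower lambda alpha) in Hlim.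
2:{ rewrite <- (Rpower_1 lambda) at 2 by easy. rewrite <- Rpower_plus. f_equal. ring. }
apply filterlim_locally with (eps := eps) in Hlim.
apply at_right_0_iff in Hlim. destruct Hlim as [e [He Hlim]].
apply at_right_0_iff. exists (Rmin e (Rmin d (d / lambda))). split.
{ repeat apply Rmin_glb_lt; try lra. now apply Rdiv_lt_0_compat. }
intros y [Hy Hyb].
apply Rmin_Rgt in Hyb. destruct Hyb as [Hye Hyb]. apply Rmin_Rgt in Hyb. destruct Hyb as [Hyd Hyl].
assert (Hly : lambda * y < d).
{ apply Rmult_gt_compat_l with (r := lambda) in Hyl; [|easy]. 
  replace (lambda * (d / lambda)) with d in Hyl by (field; lra). lra. }
assert (Hex : exists xi, 0 < xi < y /\
   lambda * Derive g (lambda * xi) * g y = g (lambda * y) * Derive g xi).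
{ set (phi := fun s => G (lambda * s) * g y - g (lambda * y) * G s).
  assert (Hphi : forall s, 0 < s < y -> is_derive phi s
    (lambda * Derive g (lambda * s) * g y - g (lambda * y) * Derive g s)).
  { intros s Hs.
    assert (HGl : is_derive (fun s => G (lambda * s)) s (lambda * Derive g (lambda * s))).
    { apply (is_derive_comp G (fun s => lambda * s)).
      - apply HGder. nra.
      - auto_derive; [easy|ring]. }
    apply (is_derive_minus (V := R_NormedModule)).
    - replace (lambda * Derive g (lambda * s) * g y)
        with (g y * (lambda * Derive g (lambda * s))) by ring.
      apply is_derive_ext with (fun s => g y * G (lambda * s)); [intros; apply Rmult_comm|].
      apply is_derive_scal, HGl.
    - apply is_derive_scal, HGder. lra. }
  assert (pr : forall s, 0 < s < y -> derivable_pt phi s)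
    by (intros s Hs; apply ex_derive_Reals_0; eexists; apply Hphi, Hs).
  destruct (Rolle phi 0 y pr) as [xi [Hxi Hz]].
  - intros s _. apply continuity_pt_filterlim.
    apply (continuous_minus (V := R_NormedModule)); apply (continuous_mult (K := R_AbsRing)).
    + apply (continuous_comp (fun s => lambda * s) G); [|apply HGcont].
      apply (@ex_derive_continuous R_AbsRing R_NormedModule). auto_derive. easy.
    + apply continuous_const.
    + apply continuous_const.
    + apply HGcont.
  - easy.
  - unfold phi. rewrite !HGg by nra. rewrite Rmult_0_r, Hg0. ring.
  - exists xi. split; [easy|].
    rewrite Derive_Reals, (is_derive_unique _ _ _ (Hphi xi Hxi)) in Hz. lra. }
destruct Hex as [xi [Hxi Heq]].
replace (g (lambda * y) / g y) with (lambda * (Derive g (lambda * xi) / Derive g xi)).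
- apply Hlim. lra.
- assert (0 < g y) by (apply Hpos; lra).
  assert (0 < Derive g xi) by (apply Hder; lra).
  apply Rmult_eq_reg_r with (g y * Derive g xi); [|nra].
  field_simplify; lra.
Qed.

(** Halving y changes ln g by at least - p' ln 2 once y is small, for any p' > alpha, so
    ln (g y) - p' ln y stays bounded below along y, y / 2, y / 4, and so on;
    monotonicity covers one dyadic block, hence all of them.  The constant is absorbed
    by taking p' strictly between alpha and p. *)
Lemma RV0_power_lower_bound (g : R -> R) (alpha p d : R) :
  0 < d -> 0 < alpha < p ->
  (forall y, 0 < y -> 0 < g y) ->
  (forall y z, 0 < y <= z -> z < d -> g y <= g z) ->
  RV0 g alpha ->
  at_right 0 (fun y => p * ln y <= ln (g y)).
Proof.
intros Hd Hp Hpos Hmono [_ Hrv].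
set (p' := (alpha + p) / 2).
assert (Hhalf : exists e, 0 < e /\ forall y, 0 < y < e -> ln (g y) - p' * ln 2 <= ln (g (y / 2))).
{ assert (Hk : Rpower (/ 2) p' < Rpower (/ 2) alpha).
  { unfold Rpower. apply exp_increasing. rewrite ln_Rinv by lra.
    assert (0 < ln 2) by (rewrite <- ln_1; apply ln_increasing; lra).
    unfold p'. nra. }
  assert (H := Hrv (/ 2) ltac:(lra) _ (open_gt (Rpower (/ 2) p') _ Hk)).
  apply at_right_0_iff in H. destruct H as [e [He H]].
  exists e. split; [easy|]. intros y Hy. specialize (H y Hy).
  assert (Hy1 := Hpos y (proj1 Hy)).
  assert (Hy2 : 0 < g (y / 2)) by (apply Hpos; lra).
  apply Rmult_lt_compat_r with (r := g y) in H; [|easy].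
  replace (/ 2 * y) with (y / 2) in H by field.
  replace (g (y / 2) / g y * g y) with (g (y / 2)) in H by (field; lra).
  apply ln_increasing in H; [|apply Rmult_lt_0_compat; [apply exp_pos|easy]].
  rewrite ln_mult in H by (try apply exp_pos; easy).
  unfold Rpower in H. rewrite ln_exp, ln_Rinv in H by lra. lra. }
destruct Hhalf as [e [He Hhalf]].
set (y1 := Rmin e d / 2).
assert (He' : 0 < Rmin e d) by (apply Rmin_glb_lt; lra).
assert (H1 := Rmin_l e d). assert (H2 := Rmin_r e d).
assert (Hy1 : 0 < y1 /\ y1 < e /\ y1 < d) by (unfold y1; lra).
set (L := ln (g (y1 / 2)) - p' * ln y1).
assert (Hdyadic : forall n y, y1 / 2 ^ S n <= y <= y1 -> L <= ln (g y) - p' * ln y).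
{ assert (Hbase : forall y, y1 / 2 <= y <= y1 -> L <= ln (g y) - p' * ln y).
  { intros y Hy.
    assert (ln y <= ln y1) by (apply ln_le; lra).
    assert (ln (g (y1 / 2)) <= ln (g y)).
    { apply ln_le; [apply Hpos; lra|apply Hmono; lra]. }
    assert (0 < p') by (unfold p'; lra). unfold L. nra. }
  induction n as [|n IH]; intros y Hy.
  - apply Hbase. simpl in Hy. lra.
  - destruct (Rle_lt_dec (y1 / 2) y); [apply Hbase; lra|].
    assert (Hpow : 0 < 2 ^ S n) by (apply pow_lt; lra).
    assert (Heq : y1 / 2 ^ S (S n) = y1 / 2 ^ S n / 2) by (simpl; field; apply pow_nonzero; lra).
    assert (0 < y1 / 2 ^ S n) by (apply Rdiv_lt_0_compat; lra).
    assert (Hy2 : L <= ln (g (2 * y)) - p' * ln (2 * y)) by (apply IH; lra).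
    specialize (Hhalf (2 * y)). replace (2 * y / 2) with y in Hhalf by field.
    rewrite ln_mult in Hy2 by lra. 
    assert (ln (g (2 * y)) - p' * ln 2 <= ln (g y)) by (apply Hhalf; lra). lra. }
apply at_right_0_iff. exists (Rmin y1 (exp (L / (p - p')))). split.
{ apply Rmin_glb_lt; [lra|apply exp_pos]. }
intros y [Hy Hyb]. apply Rmin_Rgt in Hyb. destruct Hyb as [Hyb1 Hyb2].
apply ln_increasing in Hyb2; [|easy]. rewrite ln_exp in Hyb2.
assert (Hpp : 0 < p - p') by (unfold p'; lra).
apply Rmult_lt_compat_r with (r := p - p') in Hyb2; [|easy].
replace (L / (p - p') * (p - p')) with L in Hyb2 by (field; lra).
destruct (pow_lt_1_zero (/ 2) ltac:(rewrite Rabs_right; lra) (y / y1)) as [N HN].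
{ apply Rdiv_lt_0_compat; lra. }
specialize (HN (S N) ltac:(auto)).
assert (L <= ln (g y) - p' * ln y); [|lra].
apply (Hdyadic N). split; [|lra].
rewrite pow_inv in HN. rewrite Rabs_right in HN.
2:{ apply Rle_ge, Rlt_le, Rinv_0_lt_compat, pow_lt. lra. }
apply Rmult_lt_compat_r with (r := y1) in HN; [|lra].
replace (y / y1 * y1) with y in HN by (field; lra).
unfold Rdiv. lra.
Qed.

(** The conclusion ranges over all z below lambda y because the delayed value of the
    solution is only bounded by a multiple of the current one. *)
Lemma RV0_dilation_upper (g : R -> R) (alpha lambda k d : R) :
  0 < d -> 0 < lambda ->
  (forall y, 0 < y -> 0 < g y) ->
  (forall y z, 0 < y <= z -> z < d -> g y <= g z) ->
  RV0 g alpha -> Rpower lambda alpha < k ->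
  at_right 0 (fun y => forall z, 0 < z <= lambda * y -> g z <= k * g y).
Proof.
intros Hd Hl Hpos Hmono [_ Hrv] Hk.
assert (H := Hrv lambda Hl _ (open_lt k _ Hk)).
apply at_right_0_iff in H. destruct H as [e [He H]].
apply at_right_0_iff. exists (Rmin e (d / lambda)). split.
{ apply Rmin_glb_lt; [lra|now apply Rdiv_lt_0_compat]. }
intros y [Hy Hyb] z Hz. apply Rmin_Rgt in Hyb. destruct Hyb as [Hye Hyd].
assert (Hg := Hpos y Hy). specialize (H y (conj Hy Hye)).
apply Rmult_gt_compat_l with (r := lambda) in Hyd; [|easy].
replace (lambda * (d / lambda)) with d in Hyd by (field; lra).
apply Rle_trans with (g (lambda * y)); [apply Hmono; lra|].
apply Rmult_lt_compat_r with (r := g y) in H; [|easy].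
replace (g (lambda * y) / g y * g y) with (g (lambda * y)) in H by (field; lra). lra.
Qed.

Lemma RV0_dilation_lower (g : R -> R) (alpha lambda k d : R) :
  0 < lambda ->
  (forall y, 0 < y -> 0 < g y) ->
  (forall y z, 0 < y <= z -> z < d -> g y <= g z) ->
  RV0 g alpha -> k < Rpower lambda alpha ->
  at_right 0 (fun y => forall z, lambda * y <= z < d -> k * g y <= g z).
Proof.
intros Hl Hpos Hmono [_ Hrv] Hk.
assert (H := Hrv lambda Hl _ (open_gt k _ Hk)).
apply at_right_0_iff in H. destruct H as [e [He H]].
apply at_right_0_iff. exists e. split; [easy|].
intros y Hy z Hz.
assert (Hg := Hpos y (proj1 Hy)). specialize (H y Hy).
apply Rle_trans with (g (lambda * y)); [|apply Hmono; nra].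
apply Rmult_lt_compat_r with (r := g y) in H; [|easy].
replace (g (lambda * y) / g y * g y) with (g (lambda * y)) in H by (field; lra). lra.
Qed.

(** * A maximum principle for delayed arguments *)

(** At the first zero of z its derivative cannot be negative, because z is negative
    just before; hence there is no first zero. *)
Lemma negative_of_no_upcrossing (z dz : R -> R) (T0 T : R) :
  T0 <= T ->
  (forall s, T0 <= s <= T -> z s < 0) ->
  (forall t, T <= t -> is_derive z t (dz t)) ->
  (forall t, T < t -> (forall s, T0 <= s < t -> z s < 0) -> z t = 0 -> dz t < 0) ->
  forall t, T0 <= t -> z t < 0.
Proof.
intros HT Hinit Hder Hneg t0 Ht0.
destruct (Rlt_le_dec (z t0) 0) as [|Hpos]; [easy|exfalso].
assert (HTt0 : T < t0).
{ destruct (Rle_lt_dec t0 T); [|easy]. specialize (Hinit t0). lra. }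
assert (Hlim : forall t, T <= t -> forall e, 0 < e -> exists d, 0 < d /\
  forall h, h <> 0 -> Rabs h < d -> Rabs ((z (t + h) - z t) / h - dz t) < e).
{ intros t Ht e He. generalize (Hder t Ht). rewrite is_derive_Reals. intros H.
  destruct (H e He) as [d Hd]. exists d. split. apply cond_pos. exact Hd. }
assert (Hcont : forall t, T <= t -> forall e, 0 < e -> exists d, 0 < d /\
  forall s, Rabs (s - t) < d -> Rabs (z s - z t) < e).
{ intros t Ht e He.
  assert (C : continuous z t) by (apply (@ex_derive_continuous R_AbsRing R_NormedModule); exists (dz t); auto).
  apply filterlim_locally with (eps := mkposreal e He) in C.
  destruct C as [d Hd]. exists d. split. apply cond_pos. exact Hd. }
set (E := fun t => T <= t <= t0 /\ forall s, T0 <= s <= t -> z s < 0).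
assert (HET : E T) by (split; [lra|exact Hinit]).
destruct (completeness E) as [t1 [Hub Hlub]].
{ exists t0. intros t [Ht _]. lra. }
{ exists T. exact HET. }
assert (H1 : T <= t1) by (apply Hub, HET).
assert (Hbelow : forall s, T0 <= s < t1 -> z s < 0).
{ intros s Hs. destruct (Rlt_le_dec (z s) 0) as [|Hz]; [easy|exfalso].
  assert (t1 <= s); [|lra]. apply Hlub. intros e [_ He].
  destruct (Rle_lt_dec e s); [easy|]. specialize (He s). lra. }
assert (H2 : t1 <= t0) by (apply Hlub; intros e [He _]; lra).
assert (Hnn : 0 <= z t1).
{ destruct (Rle_lt_dec 0 (z t1)) as [|Hz]; [easy|exfalso].
  destruct (Hcont t1 H1 (- z t1)) as [d [Hd Hc]]; [lra|].
  assert (H3 : t1 < t0) by (destruct H2; [easy|subst; lra]).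
  set (e := Rmin (t1 + d / 2) t0).
  assert (He : t1 < e) by (unfold e; apply Rmin_glb_lt; lra).
  assert (He1 : e <= t1 + d / 2) by apply Rmin_l.
  assert (He2 : e <= t0) by apply Rmin_r.
  assert (E e); [|specialize (Hub e); intuition lra].
  split; [lra|]. intros s Hs.
  destruct (Rlt_le_dec s t1); [apply Hbelow; lra|].
  specialize (Hc s). rewrite (Rabs_right (s - t1)) in Hc by lra.
  assert (A := Rle_abs (z s - z t1)). intuition lra. }
assert (H3 : T < t1).
{ destruct H1; [easy|]. specialize (Hinit T). subst. lra. }
assert (Hz1 : z t1 = 0).
{ destruct Hnn as [Hz|]; [exfalso|easy].
  destruct (Hcont t1 H1 (z t1) Hz) as [d [Hd Hc]].
  set (s := Rmax T (t1 - d / 2)).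
  assert (T <= s) by apply Rmax_l.
  assert (t1 - d / 2 <= s) by apply Rmax_r.
  assert (s < t1) by (apply Rmax_lub_lt; lra).
  specialize (Hc s). rewrite (Rabs_left (s - t1)) in Hc by lra.
  assert (A := Rle_abs (- (z s - z t1))). rewrite Rabs_Ropp in A.
  specialize (Hbelow s). intuition lra. }
assert (Hd1 : dz t1 < 0) by (apply Hneg; auto).
destruct (Hlim t1 H1 (- dz t1)) as [d [Hd Hc]]; [lra|].
set (h := Rmin (d / 2) (t1 - T)).
assert (0 < h) by (apply Rmin_glb_lt; lra).
assert (h <= d / 2) by apply Rmin_l.
assert (h <= t1 - T) by apply Rmin_r.
specialize (Hc (- h)). rewrite Rabs_Ropp, (Rabs_right h) in Hc by lra.
assert (A := Rle_abs ((z (t1 + - h) - z t1) / - h - dz t1)).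
assert (B : (z (t1 + - h) - z t1) / - h < 0) by (cut (- h <> 0); [intros; intuition lra|lra]).
rewrite Hz1 in B.
assert (0 < (z (t1 + - h) - 0) / - h); [|lra].
replace ((z (t1 + - h) - 0) / - h) with (- z (t1 + - h) / h) by (field; lra).
apply Rdiv_lt_0_compat; [|lra].
specialize (Hbelow (t1 + - h)). lra.
Qed.

(** T is so large that s t > T0 for all t >= T, and the level K exceeds the maximum of w
    on [T0, T], so [negative_of_no_upcrossing] applies to w - K.  At a first passage
    through K the delayed value w (s t) is still below K = w t, and K is positive;
    these are the two premises under which the derivative has to be controlled.  The
    second one makes rate estimates at the passage time independent of K. *)
Lemma bounded_above_of_delay_maximum (w dw s : R -> R) :
  (forall t, 0 < t -> is_derive w t (dw t)) ->
  is_lim s p_infty p_infty ->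
  Rbar_locally p_infty (fun t => s t < t) ->
  Rbar_locally p_infty (fun t => w (s t) <= w t -> 0 <= w t -> dw t < 0) ->
  exists C, Rbar_locally p_infty (fun t => w t <= C).
Proof.
intros Hw Hs [M1 HM1] [M2 HM2].
set (T0 := Rmax 0 (Rmax M1 M2) + 1).
assert (H0 : 0 < T0 /\ M1 < T0 /\ M2 < T0).
{ unfold T0. assert (A := Rmax_l 0 (Rmax M1 M2)). assert (B := Rmax_r 0 (Rmax M1 M2)).
  assert (C := Rmax_l M1 M2). assert (D := Rmax_r M1 M2). lra. }
apply is_lim_spec in Hs. destruct (Hs T0) as [M3 HM3].
set (T := Rmax T0 M3 + 1).
assert (HT : T0 < T /\ M3 < T).
{ unfold T. assert (A := Rmax_l T0 M3). assert (B := Rmax_r T0 M3). lra. }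
destruct (continuity_ab_maj w T0 T) as [tm [Hmax _]]; [lra| |].
{ intros c Hc. apply continuity_pt_filterlim.
  apply (@ex_derive_continuous R_AbsRing R_NormedModule). exists (dw c). apply Hw. lra. }
set (K := Rmax 0 (w tm) + 1).
assert (HK : 0 < K /\ w tm < K).
{ unfold K. assert (A := Rmax_l 0 (w tm)). assert (B := Rmax_r 0 (w tm)). lra. }
exists K. exists T. intros t Ht.
assert (w t - K < 0); [|lra].
apply (negative_of_no_upcrossing (fun t => w t - K) dw T0 T); try lra.
- intros u Hu. specialize (Hmax u Hu). lra.
- intros u Hu. replace (dw u) with (minus (dw u) 0) by (unfold minus, plus, opp; simpl; ring).
  apply (is_derive_minus (V := R_NormedModule)); [apply Hw; lra|].
  apply (is_derive_const (V := R_NormedModule)).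
- intros u Hu Hprev Heq.
  assert (w (s u) - K < 0).
  { apply Hprev. split; [apply Rlt_le, HM3; lra|apply HM1; lra]. }
  apply HM2; lra.
Qed.

(** * Power bounds for the solution *)

Lemma tends_to_0_at_right (x : R -> R) (P : R -> Prop) :
  (forall t, 0 < t -> 0 < x t) -> is_lim x p_infty 0 ->
  at_right 0 P -> Rbar_locally p_infty (fun t => P (x t)).
Proof.
intros Hpos Hlim HP. apply at_right_0_iff in HP. destruct HP as [e [He HP]].
apply is_lim_spec in Hlim. destruct (Hlim (mkposreal e He)) as [M HM].
exists (Rmax 0 M). intros t Ht.
assert (A := Rmax_l 0 M). assert (B := Rmax_r 0 M).
assert (Hx : 0 < x t) by (apply Hpos; lra).
specialize (HM t ltac:(lra)). simpl in HM. rewrite Rminus_0_r, Rabs_right in HM by lra.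
apply HP. lra.
Qed.

Lemma is_derive_log_power (x : R -> R) (m t l : R) :
  0 < t -> 0 < x t -> is_derive x t l ->
  is_derive (fun t => ln (x t) + m * ln t) t (l / x t + m / t).
Proof.
intros Ht Hx Hd.
apply (is_derive_plus (V := R_NormedModule)).
- apply (is_derive_comp ln x t (/ x t) l); [now apply is_derive_ln|easy].
- apply is_derive_scal. now apply is_derive_ln.
Qed.

(** At a time with w (s t) <= w t, where w t = ln (x t) + m ln t, the delayed value is
    at most exp (m ell) x t, so the right-hand side is at most - (a - b k) g (x t).
    The premise 0 <= w t means x t >= t ^ - m, whence
    g (x t) / x t >= t ^ (- m p); as m p < 1 this dominates the derivative m / t of
    m ln t for large t. *)
Lemma delay_power_upper_bound (x g s : R -> R) (a b m ell k p : R) :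
  0 < b -> b * k < a -> 0 < m -> 0 < p -> m * p < 1 ->
  (forall t, 0 < t -> 0 < x t) -> is_lim x p_infty 0 ->
  (forall t, 0 < t -> is_derive x t (- a * g (x t) + b * g (x (s t)))) ->
  is_lim s p_infty p_infty ->
  Rbar_locally p_infty (fun t => exp (- ell) * t <= s t < t) ->
  (forall y, 0 < y -> 0 < g y) ->
  at_right 0 (fun y => forall z, 0 < z <= exp (m * ell) * y -> g z <= k * g y) ->
  at_right 0 (fun y => (1 + p) * ln y <= ln (g y)) ->
  exists C, Rbar_locally p_infty (fun t => ln (x t) + m * ln t <= C).
Proof.
intros Hb Hk Hm Hp Hmp Hpos Hx Hder Hs Hdelay Hg Hdil Hlow.
apply bounded_above_of_delay_maximum with
  (dw := fun t => (- a * g (x t) + b * g (x (s t))) / x t + m / t) (s := s).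
- intros t Ht. apply is_derive_log_power; auto.
- easy.
- revert Hdelay. apply filter_imp. intros t Ht. apply Ht.
- (* Beyond M, ln m - ln t < ln (a - b k) - m p ln t. *)
  set (M := exp ((ln m - ln (a - b * k)) / (1 - m * p))).
  assert (HM : Rbar_locally p_infty (fun t => M < t)) by (exists M; auto).
  generalize (filter_and _ _ HM (filter_and _ _ Hdelay (filter_and _ _
    (tends_to_0_at_right x _ Hpos Hx Hdil) (tends_to_0_at_right x _ Hpos Hx Hlow)))).
  apply filter_imp. clear HM Hdelay Hdil Hlow.
  intros t [Ht [Hst [Hdil Hlow]]] Hmax Hnn.
  assert (HM : 0 < M) by apply exp_pos.
  assert (Hxt : 0 < x t) by (apply Hpos; lra).
  assert (Hgt := Hg _ Hxt).
  assert (Hexp := exp_pos (- ell)).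
  assert (Het : 0 < exp (- ell) * t) by (apply Rmult_lt_0_compat; lra).
  assert (Hxs : 0 < x (s t)) by (apply Hpos; lra).
  assert (Hlns : ln t - ell <= ln (s t)).
  { replace (ln t - ell) with (ln (exp (- ell) * t)) by (rewrite ln_mult, ln_exp by lra; ring).
    apply ln_le; lra. }
  assert (Hcmp : g (x (s t)) <= k * g (x t)).
  { apply Hdil. split; [easy|].
    assert (He := exp_pos (m * ell)).
    apply ln_le_inv; try apply Rmult_lt_0_compat; try easy.
    rewrite ln_mult, ln_exp by easy. nra. }
  assert (Hrate : m / t < (a - b * k) * g (x t) / x t).
  { apply ln_lt_inv; [apply Rdiv_lt_0_compat; lra| |].
    { apply Rdiv_lt_0_compat; [apply Rmult_lt_0_compat; lra|easy]. }
    rewrite !ln_div, ln_mult by (try apply Rmult_lt_0_compat; lra).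
    apply ln_increasing in Ht; [|easy]. unfold M in Ht. rewrite ln_exp in Ht.
    apply Rmult_lt_compat_r with (r := 1 - m * p) in Ht; [|lra].
    replace ((ln m - ln (a - b * k)) / (1 - m * p) * (1 - m * p))
      with (ln m - ln (a - b * k)) in Ht by (field; lra).
    nra. }
  assert ((- a * g (x t) + b * g (x (s t))) / x t <= - ((a - b * k) * g (x t) / x t)); [|lra].
  unfold Rdiv. rewrite <- Ropp_mult_distr_l_reverse.
  apply Rmult_le_compat_r; [left; now apply Rinv_0_lt_compat|nra].
Qed.

(** If w (s t) >= w t, where w t = ln (x t) + m ln t, the delayed value is at least
    exp (m ell) x t, which makes x, and a fortiori w, increase: - w cannot reach a new
    high level. *)
Lemma delay_power_lower_bound (x g s : R -> R) (a b m ell k d : R) :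
  0 < b -> a < b * k -> 0 < m -> 0 < ell -> 0 < d ->
  (forall t, 0 < t -> 0 < x t) -> is_lim x p_infty 0 ->
  (forall t, 0 < t -> is_derive x t (- a * g (x t) + b * g (x (s t)))) ->
  is_lim s p_infty p_infty ->
  Rbar_locally p_infty (fun t => s t <= exp (- ell) * t) ->
  (forall y, 0 < y -> 0 < g y) ->
  at_right 0 (fun y => forall z, exp (m * ell) * y <= z < d -> k * g y <= g z) ->
  exists C, Rbar_locally p_infty (fun t => - (ln (x t) + m * ln t) <= C).
Proof.
intros Hb Hk Hm Hell Hd Hpos Hx Hder Hs Hdelay Hg Hdil.
assert (Hpt : Rbar_locally p_infty (fun t => 0 < t)) by (exists 0; auto).
assert (Hps : Rbar_locally p_infty (fun t => 0 < s t)) by (apply Hs; exists 0; auto).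
assert (Hdecay : exp (- ell) < 1) by (rewrite <- exp_0; apply exp_increasing; lra).
apply bounded_above_of_delay_maximum with
  (dw := fun t => - ((- a * g (x t) + b * g (x (s t))) / x t + m / t)) (s := s).
- intros t Ht. apply (is_derive_opp (V := R_NormedModule)). apply is_derive_log_power; auto.
- easy.
- generalize (filter_and _ _ Hpt Hdelay). apply filter_imp. intros t Ht. nra.
- assert (Hsmall : Rbar_locally p_infty (fun t => x (s t) < d)).
  { apply (filterlim_comp _ _ _ s x _ _ _ Hs Hx (fun y => y < d)). now apply open_lt. }
  generalize (filter_and _ _ Hpt (filter_and _ _ Hps (filter_and _ _ Hsmall
    (filter_and _ _ Hdelay (tends_to_0_at_right x _ Hpos Hx Hdil))))).
  apply filter_imp. clear Hpt Hps Hsmall Hdelay Hdil.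
  intros t [Ht [Hst [Hsmall [Hdelay Hdil]]]] Hmax _.
  assert (Hxt := Hpos t Ht). assert (Hxs := Hpos _ Hst). assert (Hgt := Hg _ Hxt).
  assert (Hlns : ln (s t) <= ln t - ell).
  { replace (ln t - ell) with (ln (exp (- ell) * t)).
    - apply ln_le; lra.
    - rewrite ln_mult, ln_exp; [ring|apply exp_pos|easy]. }
  assert (Hcmp : k * g (x t) <= g (x (s t))).
  { apply Hdil. split; [|easy].
    assert (He := exp_pos (m * ell)).
    apply ln_le_inv; try apply Rmult_lt_0_compat; try easy.
    rewrite ln_mult, ln_exp by easy. nra. }
  assert (0 < (- a * g (x t) + b * g (x (s t))) / x t) by (apply Rdiv_lt_0_compat; nra).
  assert (0 < m / t) by now apply Rdiv_lt_0_compat.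
  lra.
Qed.

(** * Conclusion *)

Lemma is_lim_log_ratio (x : R -> R) (kappa : R) :
  0 < kappa ->
  (forall m, 0 < m < kappa ->
     exists C, Rbar_locally p_infty (fun t => ln (x t) + m * ln t <= C)) ->
  (forall m, kappa < m ->
     exists C, Rbar_locally p_infty (fun t => - (ln (x t) + m * ln t) <= C)) ->
  is_lim (fun t => ln (x t) / ln t) p_infty (- kappa).
Proof.
intros Hkappa Hup Hlow. apply is_lim_spec. intros eps.
change (Rbar_locally p_infty (fun t => Rabs (ln (x t) / ln t - - kappa) < eps)).
assert (Heps := cond_pos eps).
set (e := Rmin (eps / 2) (kappa / 2)).
assert (He : 0 < e /\ e <= eps / 2 /\ e <= kappa / 2).
{ split; [apply Rmin_glb_lt; lra|split; [apply Rmin_l|apply Rmin_r]]. }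
destruct (Hup (kappa - e)) as [C1 H1]; [lra|].
destruct (Hlow (kappa + e)) as [C2 H2]; [lra|].
set (M := Rmax 0 (Rmax (C1 / e) (C2 / e))).
assert (H3 : Rbar_locally p_infty (fun t => exp M < t)) by (exists (exp M); auto).
generalize (filter_and _ _ H3 (filter_and _ _ H1 H2)). apply filter_imp.
clear H1 H2 H3. intros t [H3 [H1 H2]].
apply ln_increasing in H3; [|apply exp_pos]. rewrite ln_exp in H3.
assert (A := Rmax_l 0 (Rmax (C1 / e) (C2 / e))). fold M in A.
assert (B := Rmax_r 0 (Rmax (C1 / e) (C2 / e))). fold M in B.
assert (A1 := Rmax_l (C1 / e) (C2 / e)). assert (A2 := Rmax_r (C1 / e) (C2 / e)).
assert (HC1 : C1 < e * ln t).
{ replace C1 with (e * (C1 / e)) by (field; lra). apply Rmult_lt_compat_l; lra. }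
assert (HC2 : C2 < e * ln t).
{ replace C2 with (e * (C2 / e)) by (field; lra). apply Rmult_lt_compat_l; lra. }
replace (ln (x t) / ln t - - kappa) with ((ln (x t) + kappa * ln t) / ln t) by (field; lra).
apply Rabs_lt_between. split.
- apply Rlt_div_r; nra.
- apply Rlt_div_l; nra.
Qed.

Theorem theorem8 :
  forall (tau g psi x : R -> R) (taubar q delta1 beta a b : R),
    (forall t : R, 0 <= t -> 0 <= tau t) ->
    continuous_on (fun t => 0 <= t) tau ->
    is_lim (fun t => t - tau t) p_infty p_infty ->
    is_glb_Rbar (fun y => exists t : R, 0 <= t /\ y = t - tau t)
      (Finite (- taubar)) ->
    0 < q < 1 ->
    is_lim (fun t => tau t / t) p_infty (Finite q) ->
    (forall y : R, 0 <= y -> 0 <= g y) ->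
    continuous_on (fun y => 0 <= y) g ->
    g 0 = 0 ->
    (forall y : R, 0 < y -> 0 < g y) ->
    0 < delta1 ->
    (forall y : R, 0 < y < delta1 ->
       ex_derive g y /\ continuous (Derive g) y /\ 0 < Derive g y) ->
    1 < beta ->
    RV0 (Derive g) (beta - 1) ->
    0 < b -> b < a ->
    a < b * Rpower (1 / (1 - q)) (beta / (beta - 1)) ->
    continuous_on (fun t => - taubar <= t <= 0) psi ->
    (forall t : R, - taubar <= t <= 0 -> 0 < psi t) ->
    is_solution a b taubar g tau psi x ->
    is_lim x p_infty (Finite 0) ->
    is_lim (fun t => ln (x t) / ln t) p_infty
      (Finite (- (1 / beta) * (1 / ln (1 / (1 - q))) * ln (a / b))).
Proof.
intros tau g psi x taubar q delta1 beta a b Htau _ Hs Hglb Hq Hratio _ Hgcont Hg0 Hgpos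
  Hd Hgder Hbeta Hrv' Hb Hab Hsub _ _ [Hxpos [_ [_ [Hxder _]]]] Hx.
set (s := fun t => t - tau t) in *.
assert (Hbar : 0 <= taubar).
{ destruct Hglb as [Hlb _].
  specialize (Hlb (s 0) ltac:(exists 0; split; [lra|easy])). simpl in Hlb.
  specialize (Htau 0 ltac:(lra)). unfold s in Hlb. lra. }
assert (Hxpos' : forall t, 0 < t -> 0 < x t) by (intros t Ht; apply Hxpos; lra).
assert (Hgder' : forall y, 0 < y < delta1 -> ex_derive g y /\ 0 < Derive g y).
{ intros y Hy. destruct (Hgder y Hy) as [H1 [_ H2]]. easy. }
assert (Hmono := increasing_of_derivative g delta1 Hgder').
assert (Hrv := RV0_primitive g beta delta1 Hd Hgcont Hg0 Hgpos Hgder' Hrv').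
set (L := ln (1 / (1 - q))) in *. set (A := ln (a / b)).
assert (HL : 0 < L).
{ unfold L. rewrite <- ln_1. apply ln_increasing; [lra|].
  apply Rmult_lt_reg_r with (1 - q); [lra|]. field_simplify; lra. }
assert (HexpL : exp (- L) = 1 - q).
{ unfold L, Rdiv. rewrite Rmult_1_l, ln_Rinv, Ropp_involutive by lra. apply exp_ln. lra. }
assert (Hba : 1 < a / b).
{ apply Rmult_lt_reg_r with b; [lra|]. field_simplify; lra. }
assert (HA : 0 < A) by (unfold A; rewrite <- ln_1; apply ln_increasing; lra).
assert (HAexp : exp A = a / b) by (apply exp_ln; lra).
set (kappa := A / (beta * L)).
assert (HbL : 0 < beta * L) by nra.
assert (HkA : kappa * (beta * L) = A) by (unfold kappa; field; lra).
assert (Hkappa : 0 < kappa) by (apply Rdiv_lt_0_compat; lra).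
assert (Hslow : kappa * (beta - 1) < 1).
{ assert (H : A < beta / (beta - 1) * L).
  { unfold Rpower in Hsub. fold L in Hsub. apply exp_lt_inv. rewrite HAexp.
    apply Rmult_lt_reg_r with b; [lra|]. field_simplify; lra. }
  apply Rmult_lt_compat_r with (r := beta - 1) in H; [|lra].
  replace (beta / (beta - 1) * L * (beta - 1)) with (beta * L) in H by (field; lra).
  rewrite <- HkA in H. nra. }
assert (Hsratio : is_lim (fun t => s t / t) p_infty (exp (- L))).
{ rewrite HexpL. apply is_lim_ext_loc with (fun t => 1 - tau t / t).
  - exists 0. intros t Ht. unfold s. field. lra.
  - apply (is_lim_minus' _ _ p_infty 1 q); [apply is_lim_const|exact Hratio]. }
assert (Hpt : Rbar_locally p_infty (fun t => 0 < t)) by (exists 0; auto).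
replace (Finite (- (1 / beta) * (1 / L) * A)) with (Finite (- kappa)).
2:{ f_equal. unfold kappa. field. lra. }
apply is_lim_log_ratio; [easy| |].
- intros m Hm.
  assert (Hmb : 0 < m * beta) by nra.
  (* ell > L allows for s t / t being only asymptotically exp (- L), and
     m beta ell < A keeps the dilated feedback weaker than the decay; both are
     possible because m < kappa. *)
  set (ell := (L + A / (m * beta)) / 2).
  assert (Hell : L < ell /\ m * beta * ell < A).
  { assert (H : L < A / (m * beta)).
    { apply Rmult_lt_reg_r with (m * beta); [easy|].
      replace (A / (m * beta) * (m * beta)) with A by (field; nra). nra. }
    assert (H' : A = m * beta * (A / (m * beta))) by (field; nra).
    unfold ell. split; [lra|]. nra. }
  assert (Hpow : Rpower (exp (m * ell)) beta < a / b).
  { unfold Rpower. rewrite ln_exp, <- HAexp. apply exp_increasing. lra. }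
  set (k := (Rpower (exp (m * ell)) beta + a / b) / 2).
  (* p > beta - 1 with m p < 1 exists because m (beta - 1) < 1. *)
  set (p := (beta - 1 + 1 / m) / 2).
  assert (Hm1 : m * (1 / m) = 1) by (field; lra).
  assert (Hp : beta - 1 < p).
  { assert (beta - 1 < 1 / m); [|unfold p; lra].
    apply Rmult_lt_reg_l with m; nra. }
  apply delay_power_upper_bound with (g := g) (s := s) (a := a) (b := b) (ell := ell) (k := k) (p := p);
    try easy.
  + replace a with (b * (a / b)) by (field; lra).
    apply Rmult_lt_compat_l; [easy|]. unfold k. lra.
  + lra.
  + unfold p. nra.
  + assert (Hexp : exp (- ell) < exp (- L)) by (apply exp_increasing; lra).
    assert (Hlt1 : exp (- L) < 1) by (rewrite HexpL; lra).
    generalize (filter_and _ _ Hpt (filter_and _ _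
      (Hsratio _ (open_gt _ _ Hexp)) (Hsratio _ (open_lt _ _ Hlt1)))).
    apply filter_imp. intros t [Ht [H1 H2]].
    apply Rlt_div_r in H1; [|easy]. apply Rlt_div_l in H2; [|easy]. lra.
  + apply RV0_dilation_upper with beta delta1; try easy; [apply exp_pos|unfold k; lra].
  + apply RV0_power_lower_bound with beta delta1; try easy. lra.
- intros m Hm.
  assert (Hmb : 0 < m * beta) by nra.
  (* As m > kappa, the point ell now lies below L and m beta ell above A. *)
  set (ell := (L + A / (m * beta)) / 2).
  assert (Hell : 0 < ell /\ ell < L /\ A < m * beta * ell).
  { assert (H : A / (m * beta) < L).
    { apply Rmult_lt_reg_r with (m * beta); [easy|].
      replace (A / (m * beta) * (m * beta)) with A by (field; nra). nra. }
    assert (0 < A / (m * beta)) by now apply Rdiv_lt_0_compat.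
    assert (H' : A = m * beta * (A / (m * beta))) by (field; nra).
    unfold ell. split; [lra|split; [lra|]]. nra. }
  assert (Hpow : a / b < Rpower (exp (m * ell)) beta).
  { unfold Rpower. rewrite ln_exp, <- HAexp. apply exp_increasing. lra. }
  set (k := (Rpower (exp (m * ell)) beta + a / b) / 2).
  apply delay_power_lower_bound with (g := g) (s := s) (a := a) (b := b) (ell := ell) (k := k) (d := delta1);
    try easy.
  + replace a with (b * (a / b)) by (field; lra).
    apply Rmult_lt_compat_l; [easy|]. unfold k. lra.
  + lra.
  + assert (Hexp : exp (- L) < exp (- ell)) by (apply exp_increasing; lra).
    generalize (filter_and _ _ Hpt (Hsratio _ (open_lt _ _ Hexp))).
    apply filter_imp. intros t [Ht H1].
    apply Rlt_div_l in H1; [|easy]. lra.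
  + apply RV0_dilation_lower with beta; try easy; [apply exp_pos|unfold k; lra].
Qed.
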